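(* Let $d$ be a positive integer. Suppose $\lambda\vdash n$ and $p_\lambda=\sum_{\mu\vdash n}R_{\lambda\mu}m_\mu$. Then $$h^{[d]}_{\lambda}=\sum_{\mu\vdash n}z^{-1}_{\mu}\,D^{[d]}_{\mu}\,R_{\mu\lambda}\,p_{\mu},\qquad\text{where } D^{[d]}_{\mu}=(-d)^{\sum_{k}n_{k(d+1)}}\ \text{ for } \mu=(1^{n_1},2^{n_2},\ldots).$$ In particular, $D^{[1]}_{\lambda}=\varepsilon_{\lambda}$ and $D^{[\infty]}_{\lambda}=1$. Moreover, the truncated homogeneous symmetric functions $h^{[d]}_{\lambda}$ form a basis of $\Lambda[x]$.
   Context: $\Lambda=\bigoplus_{n\ge 0}\Lambda^n$ (also written $\Lambda[x]=\bigoplus_{n\ge 0}\Lambda^n[x]$) is the ring of symmetric functions in the variables $x=(x_1,x_2,\ldots)$ over $\mathbb{Q}$ (or $\mathbb{Z}$, $\mathbb{R}$, $\mathbb{C}$), where $\Lambda^n$ is the subspace of homogeneous symmetric functions of degree $n$. For a positive integer $d$, the truncated homogeneous symmetric functions are defined by $\sum_{n\ge 0}h_n^{[d]}(x)t^n=\prod_{k\ge 1}(1+x_kt+x_k^2t^2+\cdots+x_k^dt^d)$ and $h^{[d]}_\lambda=\prod_i h^{[d]}_{\lambda_i}$ for an integer partition $\lambda=(\lambda_1\ge\lambda_2\ge\cdots)$. $m_\lambda$ and $p_\lambda$ denote the monomial and power sum symmetric functions, and the numbers $R_{\lambda\mu}$ (for $\lambda,\mu\vdash n$) are the coefficients in the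 expansion $p_\lambda=\sum_{\mu\vdash n}R_{\lambda\mu}m_\mu$. For $\mu=(1^{n_1},2^{n_2},\ldots)$ (that is, $\mu$ has $n_i$ parts equal to $i$), $z_\mu=\prod_{i\ge 1}i^{n_i}\cdot n_i!$ and $\varepsilon_\mu=(-1)^{|\mu|-\ell(\mu)}$, where $|\mu|$ is the sum of the parts and $\ell(\mu)$ the number of nonzero parts. The case $d=\infty$ is the convention in which no truncation occurs ($h^{[\infty]}_\lambda=h_\lambda$, the complete homogeneous symmetric function), and in $D^{[\infty]}_\mu$ the exponent is the empty sum $0$.
   Formalization: The coefficient ring is any field of characteristic 0 (such as Q, R, C); Z is excluded, since the formula needs z_μ^{-1} and the basis claim fails over Z (for d=2 in degree 3 the matrix from h^{[2]} to m has determinant -2). *)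

(* Defs.v *)
From HB Require Import structures.
From mathcomp Require Import all_boot all_order all_algebra all_fingroup.
From mathcomp Require Import boolp.
From mathcomp Require Import mpoly.

Set Implicit Arguments.
Unset Strict Implicit.
Unset Printing Implicit Defensive.

Import GRing.Theory.
Local Open Scope ring_scope.

(* -------------------------------------------------------------------- *)
(* The ring Lambda of symmetric functions in x_1, x_2, ... over K, as the
   graded inverse limit of the rings of symmetric polynomials: an element is
   a family (f_N) of symmetric polynomials f_N(x_1, ..., x_N) of bounded
   degree such that f_N(x_1, ..., x_N) = f_{N+1}(x_1, ..., x_N, 0).  The
   operations are componentwise.                                          *)

Definition kill_last (K : comNzRingType) (N : nat) (p : {mpoly K[N.+1]}) :
    {mpoly K[N]} :=
  p \mPo [tuple oapp (fun j : 'I_N => 'X_j) 0 (unlift ord_max i) | i < N.+1].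

HB.instance Definition _ (K : comNzRingType) (N : nat) :=
  GRing.RMorphism.copy (@kill_last K N)
    (comp_mpoly [tuple oapp (fun j : 'I_N => 'X_j) 0 (unlift ord_max i)
                | i < N.+1]).

HB.instance Definition _ (K : comNzRingType) (N : nat) :=
  GRing.Linear.copy (@kill_last K N)
    (comp_mpoly [tuple oapp (fun j : 'I_N => 'X_j) 0 (unlift ord_max i)
                | i < N.+1]).

Definition symfun_axiom (K : comNzRingType) (f : forall N, {mpoly K[N]}) :=
  [/\ forall N, f N \is symmetric,
      forall N, kill_last (f N.+1) = f N
    & exists D : nat, forall N, (msize (f N) <= D)%N].

Record symfun (K : comNzRingType) := Symfun {
  symfun_comp :> forall N : nat, {mpoly K[N]};
  symfunP : symfun_axiom symfun_comp }.

HB.instance Definition _ (K : comNzRingType) := gen_eqMixin (symfun K).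
HB.instance Definition _ (K : comNzRingType) := gen_choiceMixin (symfun K).

Lemma symfun_ext (K : comNzRingType) (f g : symfun K) :
  (forall N, f N = g N) -> f = g.
Proof.
case: f g => [f fP] [g gP] /= eq_fg.
have eqf : f = g by apply: functional_extensionality_dep.
by subst g; rewrite (Prop_irrelevance fP gP).
Qed.

Section SymfunRing.
Variable K : comNzRingType.
Implicit Types f g h : symfun K.

Lemma symfun0_subproof : symfun_axiom (fun N => 0 : {mpoly K[N]}).
Proof.
split=> [N|N|]; [exact: rpred0|by rewrite raddf0|].
by exists 0%N => N; rewrite mmeasure0.
Qed.

Lemma symfun1_subproof : symfun_axiom (fun N => 1 : {mpoly K[N]}).
Proof.
split=> [N|N|]; [exact: rpred1|by rewrite rmorph1|].
by exists 1%N => N; rewrite msize1.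
Qed.

Lemma symfunN_subproof f : symfun_axiom (fun N => - f N).
Proof.
case: (symfunP f) => fS fC [D fD]; split=> [N|N|]; first by rewrite rpredN fS.
  by rewrite raddfN /= fC.
by exists D => N; rewrite mmeasureN.
Qed.

Lemma symfunD_subproof f g : symfun_axiom (fun N => f N + g N).
Proof.
case: (symfunP f) (symfunP g) => fS fC [D fD] [gS gC [E gE]].
split=> [N|N|]; first by rewrite rpredD ?fS ?gS.
  by rewrite raddfD /= fC gC.
exists (maxn D E) => N; apply: leq_trans (mmeasureD_le _ _ _) _.
by rewrite geq_max !leq_max fD gE orbT.
Qed.

Lemma symfunM_subproof f g : symfun_axiom (fun N => f N * g N).
Proof.
case: (symfunP f) (symfunP g) => fS fC [D fD] [gS gC [E gE]].
split=> [N|N|]; first by rewrite rpredM ?fS ?gS.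
  by rewrite rmorphM /= fC gC.
exists (D + E).+1 => N; apply: leq_trans (msizeM_le _ _) _.
by rewrite ltnS leq_add.
Qed.

Lemma symfunZ_subproof (a : K) f : symfun_axiom (fun N => a *: f N).
Proof.
case: (symfunP f) => fS fC [D fD]; split=> [N|N|]; first by rewrite rpredZ ?fS.
  by rewrite linearZ /= fC.
by exists D => N; apply: leq_trans (msizeZ_le _ _) _.
Qed.

Definition symfun0 := Symfun symfun0_subproof.
Definition symfun1 := Symfun symfun1_subproof.
Definition symfunN f := Symfun (symfunN_subproof f).
Definition symfunD f g := Symfun (symfunD_subproof f g).
Definition symfunM f g := Symfun (symfunM_subproof f g).
Definition symfunZ a f := Symfun (symfunZ_subproof a f).

Fact symfun_addA : associative symfunD.
Proof. by move=> f g h; apply: symfun_ext => N /=; rewrite addrA. Qed.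
Fact symfun_addC : commutative symfunD.
Proof. by move=> f g; apply: symfun_ext => N /=; rewrite addrC. Qed.
Fact symfun_add0 : left_id symfun0 symfunD.
Proof. by move=> f; apply: symfun_ext => N /=; rewrite add0r. Qed.
Fact symfun_addN : left_inverse symfun0 symfunN symfunD.
Proof. by move=> f; apply: symfun_ext => N /=; rewrite addNr. Qed.

HB.instance Definition _ := GRing.isZmodule.Build (symfun K)
  symfun_addA symfun_addC symfun_add0 symfun_addN.

Fact symfun_mulA : associative symfunM.
Proof. by move=> f g h; apply: symfun_ext => N /=; rewrite mulrA. Qed.
Fact symfun_mulC : commutative symfunM.
Proof. by move=> f g; apply: symfun_ext => N /=; rewrite mulrC. Qed.
Fact symfun_mul1 : left_id symfun1 symfunM.
Proof. by move=> f; apply: symfun_ext => N /=; rewrite mul1r. Qed.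
Fact symfun_mulD : left_distributive symfunM symfunD.
Proof. by move=> f g h; apply: symfun_ext => N /=; rewrite mulrDl. Qed.
Fact symfun_1neq0 : symfun1 != symfun0.
Proof.
apply/eqP => /(congr1 (fun f : symfun K => f 0%N)) /= /eqP.
by rewrite oner_eq0.
Qed.

HB.instance Definition _ := GRing.Zmodule_isComNzRing.Build (symfun K)
  symfun_mulA symfun_mulC symfun_mul1 symfun_mulD symfun_1neq0.

Fact symfun_scaleA a b f : symfunZ a (symfunZ b f) = symfunZ (a * b) f.
Proof. by apply: symfun_ext => N /=; rewrite scalerA. Qed.
Fact symfun_scale1 : left_id 1 symfunZ.
Proof. by move=> f; apply: symfun_ext => N /=; rewrite scale1r. Qed.
Fact symfun_scaleDr : right_distributive symfunZ +%R.
Proof. by move=> a f g; apply: symfun_ext => N /=; rewrite scalerDr. Qed.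
Fact symfun_scaleDl f : {morph symfunZ^~ f : a b / a + b}.
Proof. by move=> a b; apply: symfun_ext => N /=; rewrite scalerDl. Qed.

HB.instance Definition _ := GRing.Zmodule_isLmodule.Build K (symfun K)
  symfun_scaleA symfun_scale1 symfun_scaleDr symfun_scaleDl.

Fact symfun_scaleAl (a : K) f g : a *: (f * g) = (a *: f) * g.
Proof. by apply: symfun_ext => N /=; rewrite scalerAl. Qed.

HB.instance Definition _ := GRing.Lmodule_isLalgebra.Build K (symfun K)
  symfun_scaleAl.
HB.instance Definition _ := GRing.Lalgebra_isComAlgebra.Build K (symfun K).

End SymfunRing.

(* -------------------------------------------------------------------- *)
(* Integer partitions, as weakly decreasing sequences of positive parts. *)

Definition is_partition (s : seq nat) := sorted geq s && (0%N \notin s).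

Record intpart := IntPart {
  intpart_seq :> seq nat;
  intpart_subproof : is_partition intpart_seq }.

HB.instance Definition _ := [isSub for intpart_seq].
HB.instance Definition _ := [Choice of intpart by <:].

(* Partitions of n.  The bounds on the length and on the parts hold for every
   partition of n and only serve to make the type finite, see intpartnP.  *)
Record intpartn (n : nat) := IntPartN {
  intpartn_bseq : n.-bseq 'I_n.+1;
  intpartn_subproof : is_partition (map val intpartn_bseq)
                   && (sumn (map val intpartn_bseq) == n) }.

HB.instance Definition _ (n : nat) := [isSub for @intpartn_bseq n].
HB.instance Definition _ (n : nat) := [Finite of intpartn n by <:].

Definition parts (n : nat) (s : intpartn n) : seq nat :=
  map val (intpartn_bseq s).
Coercion parts : intpartn >-> seq.

Lemma partsP (n : nat) (s : intpartn n) :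
  is_partition (parts s) /\ sumn (parts s) = n.
Proof. by case: s => s /= sP; case/andP: (sP) => ? /eqP. Qed.

Lemma parts_inj (n : nat) : injective (@parts n).
Proof. by move=> s t eq_st; apply/val_inj/val_inj/(inj_map val_inj). Qed.

Lemma intpartnP (n : nat) (s : seq nat) :
  is_partition s -> sumn s = n -> exists t : intpartn n, parts t = s.
Proof.
move=> sP sn.
have le_part i : i \in s -> (i <= n)%N.
  by move=> si; rewrite -sn sumnE (big_rem i) //= leq_addr.
have le_size : (size s <= n)%N.
  rewrite -sn; case/andP: sP => _; elim: s {sn le_part} => //= i s IHs.
  rewrite inE negb_or eq_sym -lt0n => /andP[i0 /IHs le_s].
  by rewrite -add1n leq_add.
have valK : map val (map (@inord n) s) = s.
  rewrite -map_comp -[RHS]map_id; apply/eq_in_map => i si /=.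
  by rewrite inordK // ltnS le_part.
have szP : (size (map (@inord n) s) <= n)%N by rewrite size_map.
have tP : is_partition (map val (Bseq szP)) && (sumn (map val (Bseq szP)) == n).
  by rewrite /= valK sP sn eqxx.
by exists (IntPartN tP).
Qed.

(* -------------------------------------------------------------------- *)
Lemma mcoeff_kill_last (K : comNzRingType) (N : nat) (p : {mpoly K[N.+1]}) m :
  (kill_last p)@_m = p@_(mnmwiden m).
Proof.
rewrite /kill_last comp_mpolyEX [in RHS](mpolyE p) !raddf_sum /=.
apply: eq_bigr => k _; rewrite !mcoeffZ; congr (_ * _).
rewrite comp_mpolyX big_ord_recr /= mcoeffX tnth_mktuple unlift_none /=.
under eq_bigr => i _.
  rewrite tnth_mktuple.
  have -> : widen_ord (leqnSn N) i = lift ord_max i.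
    by apply/val_inj; rewrite /= /bump leqNgt ltn_ord.
  rewrite liftK /=; over.
have [k0|k0] := eqVneq (k ord_max) 0%N; last first.
  rewrite expr0n (negPf k0) mulr0 mcoeff0; case: eqP => // eqk.
  by rewrite eqk mnmwiden_ordmax eqxx in k0.
rewrite k0 expr0 mulr1.
have -> : \prod_(i < N) ('X_i : {mpoly K[N]}) ^+ k (lift ord_max i)
    = 'X_[[multinom k (lift ord_max i) | i < N]].
  by rewrite mpolyXE_id; apply: eq_bigr => i _; rewrite mnmE.
rewrite mcoeffX; congr (_ : bool)%:R; apply/eqP/eqP => [<-|->].
  apply/mnmP => i; have [j ->|->] := unliftP ord_max i; last first.
    by rewrite mnmwiden_ordmax k0.
  have -> : lift ord_max j = widen_ord (leqnSn N) j.
    by apply/val_inj; rewrite /= /bump leqNgt ltn_ord.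
  rewrite mnmwiden_widen mnmE; congr (k _).
  by apply/val_inj; rewrite /= /bump leqNgt ltn_ord.
apply/mnmP => j; rewrite mnmE.
have -> : lift ord_max j = widen_ord (leqnSn N) j.
  by apply/val_inj; rewrite /= /bump leqNgt ltn_ord.
exact: mnmwiden_widen.
Qed.

Lemma msize_homog (K : comNzRingType) (N n : nat) (p : {mpoly K[N]}) :
  p \is n.-homog -> (msize p <= n.+1)%N.
Proof.
move/dhomogP => hp; rewrite msizeE; apply/bigmax_leqP_seq => m mp _.
by rewrite (hp m mp).
Qed.

Section MonomialSums.
Variables (K : comNzRingType) (n : nat) (P : pred (seq nat)).

(* N-variable component: sum of the monomials of degree n whose exponent
   vector satisfies P.                                                    *)
Definition monsum (N : nat) : {mpoly K[N]} :=
  \sum_(m : 'X_{1..N < n.+1} | (mdeg m == n) && P m) 'X_[m].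

Lemma mcoeff_monsum N (m : 'X_{1..N}) :
  (monsum N)@_m = ((mdeg m == n) && P m)%:R.
Proof.
rewrite /monsum raddf_sum /=.
under eq_bigr do rewrite mcoeffX.
have [/andP[/eqP deg_m Pm]|nPm] := boolP ((mdeg m == n) && P m).
  have lt_m : (mdeg m < n.+1)%N by rewrite deg_m.
  rewrite (bigD1 (BMultinom lt_m)) /= ?deg_m ?eqxx ?Pm //=.
  rewrite big1 ?addr0 // => k /andP[_ neq].
  by case: eqP => // eqk; case/eqP: neq; apply/val_inj.
rewrite big1 // => k Pk; case: eqP => // eqk.
by move: nPm; rewrite -eqk Pk.
Qed.

Lemma monsum_symfun :
    (forall s t, perm_eq s t -> P s = P t) ->
    (forall s, P (rcons s 0%N) = P s) ->
  symfun_axiom monsum.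
Proof.
move=> P_perm P_rcons0; split=> [N|N|].
- apply/issymP => s; apply/mpolyP => m.
  rewrite mcoeff_sym !mcoeff_monsum mdeg_mperm.
  congr (_ && _)%:R; apply: P_perm; apply/tuple_permP; exists s.
  by congr val; apply/eq_from_tnth => i; rewrite !tnth_mktuple.
- apply/mpolyP => m; rewrite mcoeff_kill_last !mcoeff_monsum /= P_rcons0.
  congr ((_ == n) && _)%:R.
  rewrite !mdegE big_ord_recr /= mnmwiden_ordmax addn0.
  by apply: eq_bigr => i _; rewrite mnmwiden_widen.
exists n.+1 => N; apply: msize_homog; apply/dhomogP => m.
rewrite mcoeff_msupp mcoeff_monsum.
by case: (mdeg m =P n) => // _; rewrite /= mulr0n eqxx.
Qed.
End MonomialSums.

(* -------------------------------------------------------------------- *)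
(* m_lambda = sum of the distinct monomials x^alpha, alpha ranging over the
   rearrangements of lambda (padded with zeros).                          *)

Definition is_rearr (la s : seq nat) := perm_eq [seq i <- s | i != 0%N] la.

Lemma msf_subproof (K : comNzRingType) (la : seq nat) :
  symfun_axiom (monsum K (sumn la) (is_rearr la)).
Proof.
apply: monsum_symfun => [s t eq_st|s]; rewrite /is_rearr; last first.
  by rewrite filter_rcons.
exact: (permPl (perm_filter _ eq_st)).
Qed.

Definition msf (K : comNzRingType) (la : seq nat) : symfun K :=
  Symfun (msf_subproof K la).

(* p_k = x_1^k + x_2^k + ... for k >= 1.  For k = 0 this is not a symmetric
   function: the value is set to 0, and never occurs in a partition.      *)

Definition powersum (K : comNzRingType) (k N : nat) : {mpoly K[N]} :=
  if k is 0 then 0 else \sum_(i < N) 'X_i ^+ k.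

(* \prod_k (1 + x_k t + ... + x_k^d t^d) in N variables; 'X is t, 'X_k is x_k
   and h_n^[d] is the coefficient of t^n.                                 *)

Definition hgen (K : comNzRingType) (d N : nat) : {poly {mpoly K[N]}} :=
  \prod_(k < N) \sum_(j < d.+1) ('X_k ^+ j) *: 'X^j.

Lemma kill_last_X (K : comNzRingType) (N : nat) (i : 'I_N) :
  kill_last ('X_(widen_ord (leqnSn N) i) : {mpoly K[N.+1]}) = 'X_i.
Proof.
apply/mpolyP => m; rewrite mcoeff_kill_last !mcoeffX -mnmwiden1.
by congr (_ : bool)%:R; apply: inj_eq; apply: inj_mnmwiden.
Qed.

Lemma kill_last_Xmax (K : comNzRingType) (N : nat) :
  kill_last ('X_ord_max : {mpoly K[N.+1]}) = 0.
Proof.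
apply/mpolyP => m; rewrite mcoeff_kill_last mcoeffX mcoeff0.
case: eqP => // /mnmP/(_ ord_max); rewrite mnmwiden_ordmax mnmE.
by rewrite eqxx.
Qed.

Lemma msym_X (K : comNzRingType) (N : nat) (s : 'S_N) (i : 'I_N) :
  msym s ('X_i : {mpoly K[N]}) = 'X_(s i).
Proof. by rewrite /msym mmapX mmap1U. Qed.

Lemma homog_Xn (K : comNzRingType) (N k : nat) (i : 'I_N) :
  ('X_i ^+ k : {mpoly K[N]}) \is k.-homog.
Proof.
have hX : ('X_i : {mpoly K[N]}) \is 1.-homog by rewrite dhomogX /= mdeg1.
by have := dhomogMn k hX; rewrite mul1n.
Qed.

Lemma psf_subproof (K : comNzRingType) (k : nat) :
  symfun_axiom (@powersum K k).
Proof.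
case: k => [|k]; first exact: symfun0_subproof.
split=> [N|N|].
- apply/issymP => s; rewrite /powersum raddf_sum [RHS](reindex_perm s) /=.
  by apply: eq_bigr => i _; rewrite rmorphXn /= msym_X.
- rewrite /powersum raddf_sum big_ord_recr /= rmorphXn /= kill_last_Xmax.
  rewrite expr0n addr0; apply: eq_bigr => i _.
  by rewrite rmorphXn /= kill_last_X.
exists k.+2 => N; apply: msize_homog; apply: rpred_sum => i _.
exact: homog_Xn.
Qed.

Lemma hgen_homog (K : comNzRingType) (d N n : nat) :
  (hgen K d N)`_n \is n.-homog.
Proof.
rewrite /hgen; elim/big_rec: _ n => [n|i q _ IHq n].
  rewrite coef1; case: n => [|n] /=; [exact: dhomog1|exact: dhomog0].
rewrite coefM; apply: rpred_sum => j _.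
have := dhomogM (_ : _ \is j.-homog) (IHq (n - j)%N).
rewrite subnKC -1?ltnS //; apply; rewrite coef_sum; apply: rpred_sum => k _.
rewrite coefZ coefXn; case: eqP => [->|_]; last by rewrite mulr0 dhomog0.
by rewrite mulr1 homog_Xn.
Qed.

Lemma htrunc_subproof (K : comNzRingType) (d n : nat) :
  symfun_axiom (fun N => (hgen K d N)`_n).
Proof.
split=> [N|N|].
- apply/issymP => s; rewrite -coef_map; congr ((polyseq _)`_n).
  rewrite /hgen rmorph_prod [RHS](reindex_perm s) /=; apply: eq_bigr => i _.
  rewrite raddf_sum; apply: eq_bigr => j _ /=.
  by rewrite map_polyZ map_polyXn /= rmorphXn /= msym_X.
- rewrite -coef_map /hgen rmorph_prod; congr ((polyseq _)`_n).
  rewrite big_ord_recr /= [X in _ * X](_ : _ = 1) ?mulr1.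
    apply: eq_bigr => i _; rewrite raddf_sum; apply: eq_bigr => j _ /=.
    by rewrite map_polyZ map_polyXn /= rmorphXn /= kill_last_X.
  rewrite raddf_sum big_ord_recl /= big1 ?addr0 => [|j _].
    by rewrite map_polyZ map_polyXn /= rmorphXn /= expr0 scale1r.
  by rewrite map_polyZ map_polyXn /= rmorphXn /= kill_last_Xmax expr0n scale0r.
by exists n.+1 => N; apply: msize_homog; apply: hgen_homog.
Qed.

Lemma hcomplete_subproof (K : comNzRingType) (n : nat) :
  symfun_axiom (monsum K n predT).
Proof. exact: monsum_symfun. Qed.

Definition psf (K : comNzRingType) (k : nat) : symfun K :=
  Symfun (psf_subproof K k).

(* The truncation level d is a natural number (Some d) or infinity (None);
   h_n^[oo] = h_n is the sum of all the monomials of degree n.            *)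
Definition hsf (K : comNzRingType) (d : option nat) (n : nat) : symfun K :=
  if d is Some d' then Symfun (htrunc_subproof K d' n)
  else Symfun (hcomplete_subproof K n).

Definition psf_part (K : comNzRingType) (la : seq nat) : symfun K :=
  \prod_(i <- la) psf K i.

Definition hsf_part (K : comNzRingType) (d : option nat) (la : seq nat) :
    symfun K :=
  \prod_(i <- la) hsf K d i.

(* -------------------------------------------------------------------- *)
(* The multiplicity n_i of i in mu is count_mem i mu; it vanishes for
   i > |mu| = sumn mu, which bounds the products and sums below.          *)

Definition zpart (mu : seq nat) : nat :=
  (\prod_(1 <= i < (sumn mu).+1) (i ^ count_mem i mu * (count_mem i mu)`!))%N.

Definition eps_part (mu : seq nat) : int := (-1) ^+ (sumn mu - size mu).

Definition Dpart (d : option nat) (mu : seq nat) : int :=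
  if d is Some d' then
    (- d'%:Z) ^+ (\sum_(1 <= k < (sumn mu).+1) count_mem (k * d'.+1)%N mu)%N
  else 1.

(* -------------------------------------------------------------------- *)

Definition is_basis (K : nzRingType) (V : lmodType K) (I : eqType)
    (b : I -> V) : Prop :=
  (forall (s : seq I) (c : I -> K), uniq s ->
     \sum_(i <- s) c i *: b i = 0 -> forall i, i \in s -> c i = 0)
  /\ (forall v : V, exists (s : seq I) (c : I -> K),
        v = \sum_(i <- s) c i *: b i).

(* Main.v *)
(* Write 1 + u + ... + u^d = (1 - u^(d+1)) / (1 - u) = exp (\sum_k c_k u^k / k),
   where c_k = -d if d+1 divides k and c_k = 1 otherwise, so that the product
   of the c_k over the parts of mu is D_mu.  Comparing logarithmic derivatives,
   the generating series of the h_n^[d] satisfies the Newton identities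
   n h_n = \sum_(1 <= k <= n) c_k p_k h_(n-k).  With a second set of variables
   y, both \prod_i \sum_j h_j y_i^j t^j and
   \prod_k exp (c_k p_k(x) p_k(y) t^k / k)
     = \sum_mu z_mu^-1 D_mu p_mu(x) p_mu(y) t^|mu|
   satisfy the Newton recursion with weights c_k p_k(x) p_k(y), hence agree; the
   expansion of h_lambda is the coefficient of y^lambda.

   In degree n this says that the matrix from h to m is R^T Delta R with Delta
   diagonal and invertible.  R is triangular with respect to the number of
   parts: m_la occurs in p_mu only if la is obtained by merging parts of mu.
   Hence the h_la are a basis because the m_la are.  *)
Require Import Defs.
From HB Require Import structures.
From mathcomp Require Import all_boot all_order all_algebra perm.
From mathcomp Require Import mpoly.
From mathcomp Require Import zify ring.
Import GRing.Theory.
Local Open Scope ring_scope.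

Set Implicit Arguments.
Unset Strict Implicit.
Unset Printing Implicit Defensive.

(** * Newton recursions for power series truncated at t^n *)

Section NewtonMod.
Variable B : comNzRingType.
Implicit Types A p q : {poly B}.

(** Up to degree n, [A] is t times the logarithmic derivative of [p]. The cofactor [r] turns the
    congruence modulo t^(n+1) into an equation, to which [ring] applies. *)
Definition newton_mod n A p := exists r, 'X * p^`() = A * p + 'X^(n.+1) * r.

Lemma newton_modP n A p :
  newton_mod n A p <-> forall m, (m <= n)%N -> p`_m *+ m = (A * p)`_m.
Proof.
have coef_der m : ('X * p^`())`_m = p`_m *+ m.
  by rewrite coefXM; case: m => [|m] //=; rewrite coef_deriv.
split=> [[r eq_r] m le_mn|eq_p].
  by rewrite -coef_der eq_r coefD coefXnM ltnS le_mn addr0.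
(* The quotient of the difference by t^(n+1): its coefficients up to degree n vanish by
   assumption. *)
exists (drop_poly n.+1 ('X * p^`() - A * p)).
apply/eqP; rewrite -subr_eq0 opprD addrA subr_eq0 [X in _ == X]mulrC; apply/eqP.
rewrite -[LHS](poly_take_drop n.+1) -[RHS]add0r; congr (_ + _).
apply/polyP => m; rewrite coef_take_poly coef0 ltnS; case: ifP => // le_mn.
by rewrite coefB coef_der eq_p // subrr.
Qed.

(** Logarithmic derivatives add up over a product. *)
Lemma newton_mod_prod (I : finType) n (A P : I -> {poly B}) :
  (forall i, newton_mod n (A i) (P i)) ->
  newton_mod n (\sum_i A i) (\prod_i P i).
Proof.
move=> nP; elim/big_rec2: _ => [|i a p _ [r eq_r]].
  by exists 0; rewrite derivC; ring.
have [s eq_s] := nP i; exists (s * p + r * P i).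
have -> : 'X * (P i * p)^`() = ('X * (P i)^`()) * p + P i * ('X * p^`()).
  by rewrite derivM; ring.
by rewrite eq_r eq_s; ring.
Qed.

(** As [A] has no constant term, the coefficient of t^m in [A * p] involves only coefficients of [p]
    below m. The recursion thus fixes m p_m, and torsion-freeness cancels m. *)
Lemma newton_mod_uniq n A p q :
    (forall m (x : B), x *+ m.+1 = 0 -> x = 0) ->
    A`_0 = 0 -> p`_0 = q`_0 -> newton_mod n A p -> newton_mod n A q ->
  forall m, (m <= n)%N -> p`_m = q`_m.
Proof.
move=> tf A0 pq0 /newton_modP np /newton_modP nq.
elim/ltn_ind => -[|m] IHm le_mn //.
apply/subr0_eq/(tf m); rewrite mulrnBl np // nq // !coefM -sumrB big1 // => j _.
case: (posnP j) => [->|j0]; first by rewrite A0 !mul0r subrr.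
rewrite IHm ?subrr //; first by rewrite ltn_subrL j0.
exact: leq_trans (leq_subr _ _) le_mn.
Qed.

(** Substituting x t for t multiplies the k-th weight by x^k. The cut D may lie below n if the
    omitted terms up to degree n vanish; D = n+1 makes that condition void. *)
Lemma newton_mod_scale n D (a e : nat -> B) (x : B) :
    (forall m, (D <= m <= n)%N -> e m = 0) ->
    (forall m, (m <= n)%N ->
       e m *+ m = \sum_(k < m) a k.+1 * e (m - k.+1)%N) ->
  newton_mod n (\sum_(k < n) (a k.+1 * x ^+ k.+1) *: 'X^(k.+1))
    (\poly_(j < D) (e j * x ^+ j)).
Proof.
move=> e0 ne; apply/newton_modP => m le_mn.
have coefP i : (i <= m)%N -> (\poly_(j < D) (e j * x ^+ j))`_i = e i * x ^+ i.
  move=> le_im; rewrite coef_poly; case: ltnP => // le_Di.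
  by rewrite e0 ?mul0r // le_Di (leq_trans le_im).
rewrite coefP // -mulrnAl ne // mulr_suml mulr_suml coef_sum.
rewrite (big_ord_widen_cond n xpredT
  (fun k => a k.+1 * e (m - k.+1)%N * x ^+ m)) // [LHS]big_mkcond /=.
apply: eq_bigr => k _; rewrite -scalerAl coefZ coefXnM ltnS.
case: ltnP => lt_km; last by rewrite mulr0.
rewrite coefP ?leq_subr // -{2}(subnKC lt_km) exprD; ring.
Qed.

(** Expanding the product amounts to choosing a term [f i] in each factor. *)
Lemma coef_prod_sumXn (I J : finType) (c : I -> J -> B) (w : I -> J -> nat) n :
  (\prod_i \sum_j c i j *: 'X^(w i j))`_n
    = \sum_(f : {ffun I -> J} | \sum_i w i (f i) == n) \prod_i c i (f i).
Proof.
rewrite bigA_distr_bigA /= coef_sum [RHS]big_mkcond /=.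
apply: eq_bigr => f _.
have -> : \prod_i (c i (f i) *: 'X^(w i (f i))) =
    (\prod_i c i (f i)) *: 'X^(\sum_i w i (f i)) :> {poly B}.
  elim/big_rec3: _ => [|i y1 y2 y3 _ ->]; first by rewrite scale1r expr0.
  by rewrite -scalerAl -scalerAr scalerA exprD.
by rewrite coefZ coefXn eq_sym; case: eqP; rewrite ?mulr1 ?mulr0.
Qed.

End NewtonMod.

(** * Partitions and the exponential formula *)

(** The index k < n stands for the part k+1, a shift used again below. *)
Lemma big_multiplicities (R : Type) (idx : R) (op : Monoid.com_law idx)
    (n : nat) (s : seq nat) (F : nat -> R) :
    (forall i, i \in s -> (0 < i <= n)%N) ->
  \big[op/idx]_(i <- s) F i
    = \big[op/idx]_(k < n) \big[op/idx]_(i <- s | i == k.+1) F k.+1.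
Proof.
move=> s_n; rewrite (exchange_big_dep xpredT) //=; apply: eq_big_seq => i /s_n.
case: i => [|i] //= lt_in.
by rewrite (big_pred1 (Ordinal lt_in)) //= => k; rewrite eqSS eq_sym.
Qed.

Lemma intpartn_bounds n (mu : intpartn n) i : i \in parts mu -> (0 < i <= n)%N.
Proof.
have [/andP[_ mu0] eq_n] := partsP mu.
move=> mu_i; rewrite lt0n (memPn mu0) //=.
by rewrite -eq_n sumnE (big_rem i) //= leq_addr.
Qed.

Lemma big_parts (R : Type) (idx : R) (op : Monoid.com_law idx) n
    (mu : intpartn n) (F : nat -> R) :
  \big[op/idx]_(i <- mu) F i
    = \big[op/idx]_(k < n) iterop (count_mem k.+1 (parts mu)) op (F k.+1) idx.
Proof.
rewrite (@big_multiplicities _ _ _ n); last exact: intpartn_bounds.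
by apply: eq_bigr => k _; rewrite big_const_seq -Monoid.iteropE.
Qed.

Lemma sumn_multiplicities n (mu : intpartn n) :
  (\sum_(k < n) k.+1 * count_mem k.+1 (parts mu))%N = n.
Proof.
rewrite -[RHS](partsP mu).2 sumnE big_parts.
by apply: eq_bigr => k _; rewrite Monoid.iteropE iter_addn addn0.
Qed.

Lemma prod_parts (B : comNzRingType) n (mu : intpartn n) (b : nat -> B) :
  \prod_(i <- mu) b i = \prod_(k < n) b k.+1 ^+ count_mem k.+1 (parts mu).
Proof. by rewrite big_parts. Qed.

Lemma zpart_prod n (mu : intpartn n) :
  zpart mu = (\prod_(k < n) (k.+1 ^ count_mem k.+1 (parts mu)
                             * (count_mem k.+1 (parts mu))`!))%N.
Proof.
by have [_ eq_n] := partsP mu; rewrite /zpart eq_n big_add1 big_mkord.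
Qed.

Lemma intpartn_eq n (mu nu : intpartn n) :
  (forall i, count_mem i (parts mu) = count_mem i (parts nu)) -> mu = nu.
Proof.
move=> eq_count; apply: parts_inj.
have [/andP[mu_s _] _] := partsP mu; have [/andP[nu_s _] _] := partsP nu.
apply: (sorted_eq _ _ mu_s nu_s).
- by move=> x y z /= le1 le2; apply: leq_trans le2 le1.
- by move=> x y /= /andP[? ?]; apply/eqP; rewrite eqn_leq; apply/andP.
by apply/allP => i _; rewrite /= eq_count.
Qed.

Lemma intpartn_sort n s : 0%N \notin s -> sumn s = n ->
  exists mu : intpartn n, perm_eq (parts mu) s.
Proof.
move=> s0 sum_s.
have [||mu eq_mu] := @intpartnP n (sort geq s).
- by rewrite /is_partition mem_sort s0 andbT sort_sorted // => x y; apply: leq_total.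
- by rewrite -sum_s; apply/perm_sumn; rewrite perm_sort.
by exists mu; rewrite eq_mu perm_sort.
Qed.

(** * Truncated exponentials over a field of characteristic 0 *)

Section ExpSeries.
Variables (K : fieldType) (B : comNzRingType) (iota : {rmorphism K -> B}).
Hypothesis charK : [pchar K] =i pred0.

Let natf_eq0 m : (m.+1%:R == 0 :> K) = false.
Proof. by rewrite (pcharf0P K).1. Qed.

(** The integer m+1 is invertible in K, hence also in B through [iota]. *)
Lemma iota_torsion_free m (x : B) : x *+ m.+1 = 0 -> x = 0.
Proof.
move=> xm0; rewrite -[x]mul1r -(rmorph1 iota).
have /divff <- : m.+1%:R != 0 :> K by rewrite natf_eq0.
by rewrite rmorphM rmorph_nat mulrAC mulr_natl xm0 mul0r.
Qed.

(* The summand [j] is the [j]-th term of exp(b t^(k+1) / (k+1)).  *)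
Definition exp_trunc n k (b : B) : {poly B} :=
  \sum_(j < n.+1) (iota (k.+1 ^ j * j`!)%:R^-1 * b ^+ j) *: 'X^(k.+1 * j).

(** The operator t d/dt sends term j+1 to b t^(k+1) times term j. Only b t^(k+1) times the top term
    j = n has no counterpart, and its degree (k+1)(n+1) exceeds n. *)
Lemma newton_mod_exp n k (b : B) :
  newton_mod n (b *: 'X^(k.+1)) (exp_trunc n k b).
Proof.
rewrite /exp_trunc; set u := fun j => iota (k.+1 ^ j * j`!)%:R^-1 * b ^+ j.
exists (- (b * u n) *: 'X^(k * n.+1)).
rewrite raddf_sum mulr_sumr big_ord_recl [in RHS]big_ord_recr /= mulrDr.
rewrite mulr_sumr derivZ muln0 derivXn mulr0n scaler0 mulr0 add0r.
have top0 : b *: 'X^(k.+1) * (u n *: 'X^(k.+1 * n))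
    + 'X^(n.+1) * (- (b * u n) *: 'X^(k * n.+1)) = 0.
  rewrite -scalerAl -!scalerAr scalerA -!exprD -mulnS -mulSn mulnC.
  by rewrite -scalerDl subrr scale0r.
rewrite -addrA top0 addr0; apply: eq_bigr => i _.
rewrite derivZ derivXn -scalerAr mulrnAr -exprS prednK ?muln_gt0 //.
rewrite -scalerAl -scalerAr scalerA -exprD /bump /= add1n -mulnS.
rewrite -scaler_nat scalerA; congr (_ *: _).
have -> : (k.+1 ^ i.+1 * i.+1`! = k.+1 ^ i * i`! * (k.+1 * i.+1))%N.
  by rewrite expnS factS; ring.
have cancel : iota (k.+1 * i.+1)%:R^-1 * (k.+1 * i.+1)%:R = 1.
  by rewrite -(rmorph_nat iota) -rmorphM mulVf ?rmorph1 // mulSn natf_eq0.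
move: cancel; set c := (k.+1 * i.+1)%N => cancel.
rewrite natrM invfM rmorphM exprS -[RHS]mulr1 -[X in _ = _ * X]cancel.
ring.
Qed.

(** Choosing exponents j_k with \sum_k (k+1) j_k = n is choosing the multiplicities of a partition
    of n; the denominators multiply to z_mu. *)
Lemma coef_prod_exp n (b : nat -> B) :
  (\prod_(k < n) exp_trunc n k (b k.+1))`_n
    = \sum_(mu : intpartn n) iota (zpart mu)%:R^-1 * \prod_(i <- mu) b i.
Proof.
rewrite /exp_trunc coef_prod_sumXn.
(* Multiplicities in a partition of n are at most n, so [inord] does not alter them. *)
pose mult (mu : intpartn n) : {ffun 'I_n -> 'I_n.+1} :=
  [ffun k : 'I_n => inord (count_mem k.+1 (parts mu))].
have multE mu k : mult mu k = count_mem k.+1 (parts mu) :> nat.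
  rewrite ffunE inordK // ltnS -[leqRHS](sumn_multiplicities mu).
  by rewrite (bigD1 k) //= -addnA (leq_trans _ (leq_addr _ _)) // mulSn leq_addr.
have mult_inj : injective mult.
  move=> mu nu eq_m; apply: intpartn_eq => -[|i].
    have [/andP[_ mu0] _] := partsP mu; have [/andP[_ nu0] _] := partsP nu.
    by rewrite !(count_memPn _).
  case: (ltnP i n) => [lt_in|le_ni].
    by rewrite -!(multE _ (Ordinal lt_in)) eq_m.
  by rewrite !(count_memPn _) //; apply/negP => /intpartn_bounds /=; lia.
(* Partitions correspond bijectively to multiplicity functions of weight n. *)
have mult_perm : perm_eq [seq mult mu | mu : intpartn n]
    [seq f : {ffun 'I_n -> 'I_n.+1} <- enum predT | \sum_(k < n) k.+1 * f k == n]%N.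
  apply: uniq_perm; [|exact/filter_uniq/enum_uniq|].
    by rewrite map_inj_uniq // enum_uniq.
  move=> f; rewrite mem_filter mem_enum andbT; apply/mapP/eqP => [[mu _ ->]|sum_f].
    by rewrite -[RHS](sumn_multiplicities mu); apply: eq_bigr => k _; rewrite multE.
  (* A preimage of f: [f k] copies of k+1 for each k, sorted afterwards. *)
  pose s := flatten [seq nseq (f k) k.+1 | k : 'I_n].
  have count_s (k : 'I_n) : count_mem k.+1 s = f k.
    rewrite count_flatten -map_comp sumnE big_map big_enum /=.
    rewrite (bigD1 k) //= count_nseq /= eqxx mul1n big1 ?addn0 // => j neq_jk.
    by rewrite count_nseq /= eqSS (inj_eq val_inj) (negPf neq_jk).
  have [||mu eq_mu] := @intpartn_sort n s.
  - by apply/negP => /flatten_mapP[k _]; rewrite mem_nseq andbF.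
  - rewrite sumn_flatten -map_comp sumnE big_map big_enum /= -[RHS]sum_f.
    by apply: eq_bigr => k _; rewrite sumn_nseq.
  exists mu => //; first by rewrite mem_enum.
  by apply/ffunP => k; apply/val_inj; rewrite /= -count_s -(seq.permP eq_mu) -multE.
transitivity (\sum_(f <- [seq mult mu | mu : intpartn n])
    \prod_(k < n) (iota (k.+1 ^ f k * (f k)`!)%:R^-1 * b k.+1 ^+ f k)).
  by rewrite (perm_big _ mult_perm) big_filter big_enum_cond.
rewrite big_map big_enum.
apply: eq_bigr => mu _; rewrite big_split /= -rmorph_prod prodfV -natr_prod.
rewrite zpart_prod prod_parts; congr (iota _%:R^-1 * _); apply: eq_bigr => k _.
  by rewrite multE.
by rewrite multE.
Qed.

End ExpSeries.

(** * Newton identities for the truncated homogeneous functions *)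

(* log (1 + u + ... + u^d) = \sum_k Dfactor d k * u^k / k, from
   1 + u + ... + u^d = (1 - u^(d+1)) / (1 - u). *)
Definition Dfactor (d : option nat) (k : nat) : int :=
  if d is Some d' then if (d'.+1 %| k)%N then - d'%:Z else 1 else 1.

(** Each block of d+1 consecutive weights consists of d ones and one -d, so it sums to 0. *)
Lemma sum_Dfactor d m :
  \sum_(k < m) Dfactor (Some d) k.+1 = (m %% d.+1)%N%:Z.
Proof.
elim: m => [|m IHm]; first by rewrite big_ord0 mod0n.
rewrite big_ord_recr /= IHm modnS; case: ifP => // dv; last by rewrite addrC -intS.
have : ((m %% d.+1).+1 %% d.+1 = 0)%N.
  by apply/eqP; rewrite -addn1 modnDml addn1.
have := ltn_pmod m (ltn0Sn d); rewrite ltnS leq_eqVlt => /orP[/eqP-> _|lt_m].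
  by rewrite subrr.
by rewrite modn_small.
Qed.

(** These are the Newton identities for 1 + u + ... + u^d. For m > d the nonzero terms form a window
    of d+1 consecutive weights, whose sum is 0: it is a difference of two partial sums with the same
    residue modulo d+1. *)
Lemma newton_Dfactor d m :
  (m <= d)%N%:R *+ m = \sum_(k < m) Dfactor (Some d) k.+1 * (m - k.+1 <= d)%N%:R.
Proof.
have [le_md|lt_dm] := leqP m d.
  rewrite (eq_bigr (fun k : 'I_m => Dfactor (Some d) k.+1)) => [|k _].
    by rewrite sum_Dfactor modn_small -?natz.
  by rewrite (leq_trans (leq_subr _ _) le_md) mulr1.
rewrite mul0rn.
transitivity (\sum_(k < m) Dfactor (Some d) k.+1
              - \sum_(k < m - d.+1) Dfactor (Some d) k.+1).
  by rewrite !sum_Dfactor -{1}(subnK lt_dm) modnDr subrr.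
rewrite [X in _ - X](big_ord_widen m (fun k => Dfactor (Some d) k.+1)) ?leq_subr //.
rewrite [X in _ - X]big_mkcond /= -sumrB.
apply: eq_bigr => k _; case: ltnP => lt_k.
  by rewrite [(_ <= d)%N](_ : _ = false) ?mulr0 ?subrr //; lia.
by rewrite [(_ <= d)%N](_ : _ = true) ?mulr1 ?subr0 //; lia.
Qed.

(** The factor of the variable X_i has weights c_k X_i^k; adding them over i gives c_k p_k. *)
Lemma newton_mod_hgen (K : comNzRingType) (d N n : nat) :
  newton_mod n
    (\sum_(k < n) ((Dfactor (Some d) k.+1)%:~R * powersum K k.+1 N) *: 'X^(k.+1))
    (hgen K d N).
Proof.
have nP (i : 'I_N) : newton_mod n
    (\sum_(k < n) ((Dfactor (Some d) k.+1)%:~R * 'X_i ^+ k.+1) *: 'X^(k.+1))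
    (\sum_(j < d.+1) ('X_i ^+ j : {mpoly K[N]}) *: 'X^j).
  have := @newton_mod_scale _ n d.+1 (fun k => (Dfactor (Some d) k)%:~R)
    (fun j => (j <= d)%N%:R) ('X_i : {mpoly K[N]}).
  rewrite poly_def; under [X in newton_mod _ _ X]eq_bigr => j _.
    rewrite -ltnS ltn_ord mul1r; over.
  apply=> [m /andP[le_dm _]|m _]; first by rewrite leqNgt le_dm.
  have := congr1 (fun z : int => z%:~R : {mpoly K[N]}) (newton_Dfactor d m).
  rewrite rmorphMn rmorph_nat /= => ->; rewrite rmorph_sum; apply: eq_bigr => k _.
  by rewrite rmorphM rmorph_nat.
have := newton_mod_prod nP; rewrite exchange_big /=.
congr (newton_mod n _ _); apply: eq_bigr => k _.
by rewrite -scaler_suml mulr_sumr.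
Qed.

(** The monomial m forces the choice j = [m i] in factor i. The bound n <= D keeps these exponents
    within the truncation. *)
Lemma mcoeff_coef_prod (B : comNzRingType) M D n (e : nat -> B) (m : 'X_{1..M}) :
    (n <= D)%N ->
  ((\prod_(i < M) \sum_(j < D.+1) (e j *: 'X_i ^+ j) *: 'X^j)`_n)@_m
    = (mdeg m == n)%:R * \prod_(i < M) e (m i).
Proof.
move=> le_nD; rewrite coef_prod_sumXn raddf_sum /=.
have coefE (f : {ffun 'I_M -> 'I_D.+1}) :
    (\prod_i (e (f i) *: 'X_i ^+ f i))@_m
      = (\prod_i e (f i)) * ([multinom f i : nat | i < M] == m)%:R.
  rewrite scaler_prod mcoeffZ; congr (_ * _).
  rewrite -mcoeffX mpolyXE_id; congr mcoeff; apply: eq_bigr => i _.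
  by rewrite mnmE.
under eq_bigr do rewrite coefE.
have [deg_m|ndeg_m] := eqVneq; last first.
  rewrite mul0r big1 // => f /eqP sum_f; case: eqP => [eq_m|]; last by rewrite mulr0.
  case/eqP: ndeg_m; rewrite -eq_m mdegE -sum_f.
  by apply: eq_bigr => i _; rewrite mnmE.
have m_le i : (m i < D.+1)%N.
  by rewrite ltnS (leq_trans _ le_nD) // -deg_m mdegE (bigD1 i) //= leq_addr.
have mE : [multinom ([ffun i => inord (m i)] : {ffun 'I_M -> 'I_D.+1}) i : nat
           | i < M] = m.
  by apply/mnmP => i; rewrite mnmE ffunE inordK.
rewrite (bigD1 [ffun i => inord (m i)]) /=; last first.
  by rewrite -deg_m mdegE; apply/eqP/eq_bigr => i _; rewrite ffunE inordK.
rewrite mE eqxx mulr1 mul1r [X in _ + X]big1 ?addr0.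
  by apply: eq_bigr => i _; rewrite ffunE inordK.
move=> f /andP[_ neq_f]; case: eqP => [eq_m|]; last by rewrite mulr0.
case/eqP: neq_f; apply/ffunP => i; apply/val_inj.
by rewrite ffunE /= inordK // -eq_m mnmE.
Qed.

(** Truncation at level D >= n is invisible in degree n, which reduces the case d = oo to a finite
    level. *)
Lemma hcomplete_coef_hgen (K : comNzRingType) (D N n : nat) : (n <= D)%N ->
  monsum K n predT N = (hgen K D N)`_n.
Proof.
move=> le_nD; apply/mpolyP => m; rewrite mcoeff_monsum andbT.
have := mcoeff_coef_prod (fun=> 1 : K) m le_nD.
rewrite [X in _ * X]big1 // mulr1 => <-; congr ((polyseq _)`_n)@_m.
by apply: eq_bigr => i _; apply: eq_bigr => j _; rewrite scale1r.
Qed.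

Lemma symfun_sumE (K : comNzRingType) (I : Type) (r : seq I) (P : pred I)
    (F : I -> symfun K) N :
  (\sum_(i <- r | P i) F i) N = \sum_(i <- r | P i) F i N.
Proof. exact: (big_morph (fun f : symfun K => f N)). Qed.

Lemma symfun_prodE (K : comNzRingType) (I : Type) (r : seq I) (P : pred I)
    (F : I -> symfun K) N :
  (\prod_(i <- r | P i) F i) N = \prod_(i <- r | P i) F i N.
Proof. exact: (big_morph (fun f : symfun K => f N)). Qed.

Lemma symfunMnE (K : comNzRingType) (f : symfun K) n N : (f *+ n) N = f N *+ n.
Proof. by elim: n => // n IHn; rewrite !mulrS -IHn. Qed.

Lemma symfun_intrE (K : comNzRingType) (z : int) N :
  (z%:~R : symfun K) N = z%:~R.
Proof.
case: z => n; first exact: symfunMnE.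
by rewrite !NegzE !mulrNz; apply: (congr1 -%R (symfunMnE 1 n.+1 N)).
Qed.

Lemma hsf_newton (K : comNzRingType) d m :
  hsf K d m *+ m
    = \sum_(k < m) (Dfactor d k.+1)%:~R * psf K k.+1 * hsf K d (m - k.+1)%N.
Proof.
apply: symfun_ext => N; rewrite symfunMnE symfun_sumE.
(* For d = oo the level m suffices: m+1 divides none of 1, ..., m, so all the weights used equal
   1. *)
pose D := if d is Some d' then d' else m.
have hE i : (i <= m)%N -> hsf K d i N = (hgen K D N)`_i.
  by rewrite {}/D; case: d => // le_im; apply: hcomplete_coef_hgen.
have DfE k : (k < m)%N -> Dfactor (Some D) k.+1 = Dfactor d k.+1.
  rewrite /D; case: (d) => // lt_km /=.
  by case: ifP => // /dvdn_leq; rewrite ltnS; lia.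
have /newton_modP/(_ m (leqnn m)) := newton_mod_hgen K D N m.
rewrite hE // => ->; rewrite mulr_suml coef_sum; apply: eq_bigr => k _.
rewrite -scalerAl coefZ coefXnM DfE //= symfun_intrE.
by rewrite ltnNge ltn_ord /= hE ?leq_subr.
Qed.

Lemma hsf0 (K : comNzRingType) d : hsf K d 0 = 1.
Proof.
have hgen0 D N : (hgen K D N)`_0 = 1.
  rewrite /hgen; elim/big_rec: _ => [|i p _ p0]; first by rewrite coef1.
  rewrite coef0M p0 mulr1 big_ord_recl coefD coefZ coefXn mulr1 coef_sum.
  by rewrite big1 ?addr0 // => j _; rewrite coefZ coefXn mulr0.
apply: symfun_ext => N; case: d => [d|]; first exact: hgen0.
by rewrite /= (hcomplete_coef_hgen K N (leqnn 0)) hgen0.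
Qed.

(** A positive part divisible by d+1 is k(d+1) for exactly one k >= 1 and contributes one factor -d.
    Zero must be excluded: d+1 divides it, but the exponent in [Dpart] does not count it. *)
Lemma Dpart_prod d (s : seq nat) : 0%N \notin s ->
  Dpart d s = \prod_(i <- s) Dfactor d i.
Proof.
case: d => [d|] s0 /=; last by rewrite big1.
have -> : \prod_(i <- s) (if (d.+1 %| i)%N then - d%:Z else 1)
    = (- d%:Z) ^+ count (dvdn d.+1) s.
  elim: s {s0} => [|i s IHs]; first by rewrite big_nil.
  by rewrite big_cons IHs /= exprD; case: ifP; rewrite ?expr0 ?expr1.
congr (_ ^+ _).
have s_n i : i \in s -> (0 < i <= sumn s)%N.
  move=> si; rewrite lt0n (memPn s0) //=.
  by rewrite sumnE (big_rem i) //= leq_addr.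
rewrite big_add1 big_mkord -sum1_count [RHS]big_mkcond /=.
under eq_bigr => k _ do rewrite -sum1_count.
rewrite (exchange_big_dep xpredT) //=; apply: eq_big_seq => i si.
have /andP[i_gt0 le_i] := s_n i si.
case: ifP => [/dvdnP[[|q] def_i]|ndv]; last 1 first.
- by rewrite big1 // => k /eqP def_i; rewrite def_i dvdn_mull in ndv.
- by rewrite def_i in i_gt0.
have lt_q : (q < sumn s)%N by apply: leq_trans le_i; rewrite def_i leq_pmulr.
rewrite (big_pred1 (Ordinal lt_q)) // => k.
by rewrite /= def_i eqn_pmul2r // eqSS eq_sym.
Qed.

Lemma Dpart1 (la : intpart) : Dpart (Some 1%N) la = eps_part la.
Proof.
case: la => s sP; have /andP[_ s0] := sP; rewrite Dpart_prod // /eps_part.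
(* The inequality is carried through the induction to control the truncated subtraction; each part i
   contributes (-1)^(i-1). *)
have : (size s <= sumn s)%N /\
    \prod_(i <- s) Dfactor (Some 1%N) i = (-1) ^+ (sumn s - size s).
  elim: s s0 {sP} => [|i s IHs] /=; first by rewrite big_nil.
  rewrite inE negb_or eq_sym big_cons -lt0n => /andP[i0 /IHs[le_s ->]].
  split; first by rewrite -add1n leq_add.
  have -> : (i + sumn s - (size s).+1 = i.-1 + (sumn s - size s))%N by lia.
  rewrite exprD; congr (_ * _); case: i i0 => // i _ /=.
  by rewrite dvdn2 /= negbK -signr_odd; case: odd.
by case.
Qed.

(** * Coefficients of symmetric functions *)

Definition mnm_of (s : seq nat) : 'X_{1..size s} :=
  [multinom nth 0%N s i | i < size s].

Lemma mnm_ofE s : mnm_of s = s :> seq nat.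
Proof.
apply: (@eq_from_nth _ 0%N) => [|i]; rewrite size_tuple // => lt_i.
have := mnmE (fun i : 'I_(size s) => nth 0%N s i) (Ordinal lt_i).
by rewrite mnm_tnth (tnth_nth 0%N).
Qed.

Lemma mdeg_mnm_of s : mdeg (mnm_of s) = sumn s.
Proof.
rewrite mdegE sumnE [in RHS](big_nth 0%N) big_mkord.
by apply: eq_bigr => i _; rewrite mnmE.
Qed.


Section Coefficients.
Variable K : comNzRingType.
Implicit Types (f g : symfun K) (s t : seq nat).

(** By stability the coefficient of x^s does not depend on the number of variables beyond the length
    of s, so it is read in exactly [size s] variables. *)
Definition coefsf s f : K := (f (size s))@_(mnm_of s).

Lemma coefsf_is_scalar s : scalar (coefsf s).
Proof. by move=> a f g; rewrite /coefsf mcoeffD mcoeffZ. Qed.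

HB.instance Definition _ s :=
  GRing.isLinear.Build K (symfun K) K *%R (coefsf s) (coefsf_is_scalar s).

Lemma mcoeff_coefsf f N (m : 'X_{1..N}) s :
  m = s :> seq nat -> (f N)@_m = coefsf s f.
Proof.
move=> eq_ms; have eN : N = size s by rewrite -eq_ms size_tuple.
subst N; rewrite /coefsf; congr mcoeff.
by apply/val_inj/val_inj; rewrite /= mnm_ofE.
Qed.

Lemma symfun_coef_ext f g : (forall s, coefsf s f = coefsf s g) -> f = g.
Proof.
move=> eq_fg; apply: symfun_ext => N; apply/mpolyP => m.
by rewrite !(mcoeff_coefsf _ (erefl (m : seq nat))).
Qed.

Lemma coefsf_perm f s t : perm_eq s t -> coefsf s f = coefsf t f.
Proof.
move=> eq_st; have /tuple_permP[p def_s] : perm_eq s (in_tuple t) by [].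
rewrite [RHS]/coefsf.
have [/(_ (size t))/issymP/(_ p) <- _ _] := symfunP f.
rewrite mcoeff_sym; symmetry; apply: mcoeff_coefsf.
rewrite def_s; congr val; apply/eq_from_tnth => i.
by rewrite !tnth_mktuple mnmE (tnth_nth 0%N).
Qed.

Lemma coefsf_rcons0 f s : coefsf (rcons s 0%N) f = coefsf s f.
Proof.
rewrite [RHS]/coefsf; have [_ /(_ (size s)) <- _] := symfunP f.
rewrite mcoeff_kill_last; symmetry; apply: mcoeff_coefsf.
by rewrite /= mnm_ofE.
Qed.

(** Symmetry moves the zeros to the end, where stability removes them one by one. *)
Lemma coefsf_nonzero f s : coefsf s f = coefsf [seq i <- s | i != 0%N] f.
Proof.
have /permPl/(coefsf_perm f) <- := perm_filterC (fun i => i != 0%N) s.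
have /all_pred1P -> : all (pred1 0%N) (filter (predC (fun i => i != 0%N)) s).
  by apply/allP => i; rewrite mem_filter /= negbK => /andP[].
elim: (size _) => [|k IHk]; first by rewrite cats0.
by rewrite -addn1 nseqD catA cats1 coefsf_rcons0.
Qed.

Lemma coefsf_msf la s :
  coefsf s (msf K la) = ((sumn s == sumn la) && is_rearr la s)%:R.
Proof. by rewrite /coefsf /= mcoeff_monsum mdeg_mnm_of mnm_ofE. Qed.

Lemma intpartn_nonzero n (mu : intpartn n) :
  [seq i <- parts mu | i != 0%N] = parts mu.
Proof.
apply/all_filterP/allP => i mu_i; have [/andP[_ mu0] _] := partsP mu.
exact: (memPn mu0).
Qed.

Lemma coefsf_msf_parts n (mu la : intpartn n) :
  coefsf (parts mu) (msf K la) = (mu == la)%:R.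
Proof.
rewrite coefsf_msf !(partsP _).2 eqxx /is_rearr intpartn_nonzero /=.
congr (_ : bool)%:R; apply/idP/eqP => [eq_mu|->]; last exact: perm_refl.
by apply: intpartn_eq => i; apply/seq.permP.
Qed.

Lemma coefsf_intpartn n s : sumn s = n ->
  exists mu : intpartn n, forall f, coefsf s f = coefsf (parts mu) f.
Proof.
move=> sum_s; have [||mu eq_mu] := @intpartn_sort n [seq i <- s | i != 0%N].
- by rewrite mem_filter.
- rewrite -sum_s !sumnE big_filter [RHS](bigID (fun i => i != 0%N)) /=.
  by rewrite [X in (_ + X)%N]big1 ?addn0 // => i /negbNE/eqP.
by exists mu => f; rewrite coefsf_nonzero (coefsf_perm f eq_mu).
Qed.

Definition homogsf n f := forall N, f N \is n.-homog.

Lemma coefsf_homog n f s : homogsf n f -> sumn s != n -> coefsf s f = 0.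
Proof.
by move=> /(_ (size s))/dhomog_nemf_coeff; rewrite -mdeg_mnm_of => hf /hf.
Qed.

Lemma homogsf_prod (F : nat -> symfun K) la :
  (forall i, homogsf i (F i)) -> homogsf (sumn la) (\prod_(i <- la) F i).
Proof.
move=> hF N; rewrite symfun_prodE; elim: la => [|i la IHla] /=.
  by rewrite big_nil dhomog1.
by rewrite big_cons; apply: dhomogM => //; apply: hF.
Qed.

Lemma homogsf_hsf_part d la : homogsf (sumn la) (hsf_part K d la).
Proof.
apply: homogsf_prod => i N; case: d => [d|]; first exact: hgen_homog.
by rewrite /= (hcomplete_coef_hgen K N (leqnn i)) hgen_homog.
Qed.

(** The sum on the left is the homogeneous component of f of degree n. *)
Lemma coefsf_component n f s :
  coefsf s (\sum_(mu : intpartn n) coefsf (parts mu) f *: msf K mu)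
    = (sumn s == n)%:R * coefsf s f.
Proof.
rewrite linear_sum /=; have [sum_s|nsum_s] := eqVneq (sumn s) n; last first.
  rewrite mul0r big1 // => mu _; rewrite linearZ /= coefsf_msf.
  by rewrite (partsP mu).2 (negPf nsum_s) mulr0.
have [nu eq_nu] := coefsf_intpartn sum_s; rewrite mul1r (bigD1 nu) //=.
rewrite big1 ?addr0 => [|mu neq]; rewrite linearZ /= !eq_nu coefsf_msf_parts.
  by rewrite eqxx mulr1.
by rewrite eq_sym (negPf neq) mulr0.
Qed.

Lemma homogsf_expand n f : homogsf n f ->
  f = \sum_(mu : intpartn n) coefsf (parts mu) f *: msf K mu.
Proof.
move=> hf; apply: symfun_coef_ext => s; rewrite coefsf_component.
by case: eqVneq => [_|/(coefsf_homog hf) ->]; rewrite ?mul1r ?mulr0.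
Qed.

(** The uniform degree bound in the definition of [symfun] makes the sum of components finite. *)
Lemma symfun_expand f : exists D,
  f = \sum_(n < D) \sum_(mu : intpartn n) coefsf (parts mu) f *: msf K mu.
Proof.
have [_ _ [D fD]] := symfunP f; exists D.
apply: symfun_coef_ext => s; rewrite linear_sum /=.
under eq_bigr do rewrite coefsf_component.
have [lt_sD|le_Ds] := ltnP (sumn s) D.
  rewrite (bigD1 (Ordinal lt_sD)) //= eqxx mul1r big1 ?addr0 // => n neq.
  rewrite [_ == _](_ : _ = false) ?mul0r //.
  by apply: contraNF neq => /eqP eq_n; apply/eqP/val_inj.
rewrite big1 => [|n _]; last by rewrite gtn_eqF ?mul0r // (leq_trans (ltn_ord n)).
apply: memN_msupp_eq0; apply/negP => /msize_mdeg_lt; rewrite mdeg_mnm_of.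
by rewrite ltnNge (leq_trans (fD _) le_Ds).
Qed.

End Coefficients.

(** * Power sum expansion *)

(** Power sums have scalar coefficients, so in the variables y over Lambda their coefficients still
    come from K. *)
Lemma powersum_map (K : comNzRingType) (A : comAlgType K) k M :
  powersum A k M = map_mpoly (in_alg A) (powersum K k M).
Proof.
case: k => [|k]; first by rewrite /= rmorph0.
rewrite /powersum rmorph_sum; apply: eq_bigr => i _.
by rewrite rmorphXn /= map_mpolyX.
Qed.

Lemma hsf_part_psf_part (K : fieldType) (charK : [pchar K] =i pred0) d n
    (la : intpartn n) :
  hsf_part K d la =
  \sum_(mu : intpartn n)
     ((zpart mu)%:R^-1 * (Dpart d mu)%:~R
        * coefsf (parts la) (psf_part K mu)) *: psf_part K mu.
Proof.
(* The coefficient ring [A] holds the symmetric functions in x; the M polynomial variables are the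
   y_i, one for each part of la. *)
pose A := symfun K; pose M := size la.
pose iota : {rmorphism K -> {mpoly A[M]}} := @mpolyC M A \o in_alg A.
pose b k : {mpoly A[M]} :=
  ((Dfactor d k)%:~R * psf K k : A)%:MP * powersum A k M.
pose P : {poly {mpoly A[M]}} :=
  \prod_(i < M) \sum_(j < n.+1) (hsf K d j *: 'X_i ^+ j) *: 'X^j.
pose Q := \prod_(k < n) exp_trunc iota n k (b k.+1).
have nP : newton_mod n (\sum_(k < n) b k.+1 *: 'X^(k.+1)) P.
  have nPi (i : 'I_M) : newton_mod n
      (\sum_(k < n) (((Dfactor d k.+1)%:~R * psf K k.+1 : A)%:MP * 'X_i ^+ k.+1)
          *: 'X^(k.+1))
      (\sum_(j < n.+1) (hsf K d j *: ('X_i : {mpoly A[M]}) ^+ j) *: 'X^j).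
    have := @newton_mod_scale _ n n.+1 (fun k => ((Dfactor d k)%:~R * psf K k)%:MP)
      (fun j => (hsf K d j)%:MP) ('X_i : {mpoly A[M]}).
    rewrite poly_def; under [X in newton_mod _ _ X]eq_bigr do rewrite mul_mpolyC.
    apply=> m; first by case: ltngtP.
    move=> _; rewrite -mpolyCMn hsf_newton raddf_sum; apply: eq_bigr => k _ /=.
    by rewrite mpolyCM.
  have := newton_mod_prod nPi; rewrite exchange_big /=.
  congr (newton_mod n _ _); apply: eq_bigr => k _.
  by rewrite -scaler_suml -mulr_sumr.
have nQ : newton_mod n (\sum_(k < n) b k.+1 *: 'X^(k.+1)) Q.
  by apply: newton_mod_prod => k; apply: newton_mod_exp.
have coef0_sum (e : nat -> {mpoly A[M]}) k :
    e 0%N = 1 -> (\sum_(j < n.+1) e j *: 'X^(k.+1 * j))`_0 = 1.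
  move=> e0; rewrite coef_sum big_ord_recl coefZ muln0 coefXn e0 mulr1.
  rewrite big1 ?addr0 //.
  by move=> j _; rewrite coefZ coefXn mulr0.
have P0 : P`_0 = 1.
  rewrite coef0_prod big1 // => i _.
  have := coef0_sum (fun j => hsf K d j *: 'X_i ^+ j) 0%N.
  by under eq_bigr do rewrite mul1n; apply; rewrite hsf0 scale1r.
have Q0 : Q`_0 = 1.
  rewrite coef0_prod big1 // => k _.
  apply: (coef0_sum (fun j => iota (k.+1 ^ j * j`!)%:R^-1 * b k.+1 ^+ j)).
  by rewrite expr0 mulr1 expn0 fact0 mul1n invr1 rmorph1.
have PQ : P`_n = Q`_n.
  apply: (newton_mod_uniq _ _ _ nP nQ (leqnn n)); last by rewrite P0 Q0.
    exact: (iota_torsion_free iota charK).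
  by rewrite coef_sum big1 // => k _; rewrite coefZ coefXn mulr0.
have [/andP[_ la0] sum_la] := partsP la.
(* The coefficient of y^la is h_la(x) on the left; on the right, p_mu(y) contributes its coefficient
   at la. *)
move/(congr1 (mcoeff (mnm_of la))): PQ; rewrite mcoeff_coef_prod //.
rewrite mdeg_mnm_of sum_la eqxx mul1r coef_prod_exp // raddf_sum /=.
have -> : \prod_(i < M) hsf K d (mnm_of la i) = hsf_part K d la.
  by rewrite /hsf_part (big_nth 0%N) big_mkord; apply: eq_bigr => i _; rewrite mnmE.
move=> ->; apply: eq_bigr => mu _.
have [/andP[_ mu0] _] := partsP mu.
rewrite big_split /= mcoeffCM -rmorph_prod /= mcoeffCM big_split /=.
have -> : \prod_(i <- mu) powersum A i M = map_mpoly (in_alg A) (psf_part K mu M).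
  rewrite /psf_part symfun_prodE rmorph_prod; apply: eq_bigr => i _.
  exact: powersum_map.
rewrite mcoeff_map_mpoly -rmorph_prod -Dpart_prod //=.
rewrite -(rmorph_int (in_alg A)) /psf_part.
rewrite mulr_algr mulr_algl mulr_algl !scalerA.
by congr (_ *: _); rewrite mulrAC.
Qed.

(** * Bases *)

Section FiniteSpan.
Variables (K : nzRingType) (V : lmodType K) (I : eqType) (b : I -> V).

(** Distinct indices let two combinations be merged over the union of their index lists, since no
    coefficient is then counted twice. *)
Definition in_span (v : V) :=
  exists (s : seq I) (c : I -> K), uniq s /\ v = \sum_(i <- s) c i *: b i.

Lemma in_spanZ a i : in_span (a *: b i).
Proof. by exists [:: i], (fun=> a); rewrite big_seq1. Qed.

Lemma in_spanD u v : in_span u -> in_span v -> in_span (u + v).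
Proof.
have extend (s t : seq I) (c : I -> K) : uniq s -> uniq t -> {subset s <= t} ->
    \sum_(i <- s) c i *: b i = \sum_(i <- t) (if i \in s then c i else 0) *: b i.
  move=> s_uniq t_uniq sub_st.
  have st : perm_eq s [seq i <- t | i \in s].
    apply: uniq_perm => // [|i]; first exact: filter_uniq.
    by rewrite mem_filter; case: (boolP (i \in s)) => //= /sub_st ->.
  rewrite [RHS](bigID (mem s)) /= [X in _ + X]big1 ?addr0; last first.
    by move=> i /negPf ->; rewrite scale0r.
  rewrite -[RHS]big_filter -(perm_big _ st) /= [LHS]big_seq [RHS]big_seq.
  by apply: eq_bigr => i ->.
move=> [s [c [s_uniq ->]]] [t [e [t_uniq ->]]].
have [sub1 sub2] : {subset s <= undup (s ++ t)} /\ {subset t <= undup (s ++ t)}.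
  by split=> i i_in; rewrite mem_undup mem_cat i_in ?orbT.
rewrite (extend _ _ c s_uniq (undup_uniq _) sub1).
rewrite (extend _ _ e t_uniq (undup_uniq _) sub2) -big_split /=.
exists (undup (s ++ t)).
exists (fun i => (if i \in s then c i else 0) + (if i \in t then e i else 0)).
by split; [exact: undup_uniq|apply: eq_bigr => i _; rewrite scalerDl].
Qed.

Lemma in_span_sum (J : Type) (r : seq J) (F : J -> V) :
  (forall j, in_span (F j)) -> in_span (\sum_(j <- r) F j).
Proof.
move=> hF; elim/big_rec: _ => [|j v _ hv]; last exact: in_spanD.
by exists [::], (fun=> 0); rewrite big_nil.
Qed.

End FiniteSpan.

(** Let v be a nonzero vector in the left kernel and i an index of its support with w maximal.
    Column i then receives only the term v_i M_ii, which is nonzero. *)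
Lemma triangular_unitmx (K : fieldType) (T : finType) (w : T -> nat)
    (M : T -> T -> K) :
    (forall i, M i i != 0) ->
    (forall i j, M i j != 0 -> (w j <= w i)%N /\ (w i = w j -> i = j)) ->
  (\matrix_(i < #|T|, j < #|T|) M (enum_val i) (enum_val j)) \in unitmx.
Proof.
move=> diag tri; rewrite -row_free_unit; apply: inj_row_free => v vM0.
apply/eqP/contraT => /rV0Pn[i0 vi0].
have [i vi i_max] :=
  @arg_maxnP _ i0 (fun i => v 0 i != 0) (fun i => w (enum_val i)) vi0.
have /rowP/(_ i) := vM0; rewrite !mxE (bigD1 i) //= mxE.
rewrite big1 ?addr0 => [/eqP|j neq_ji].
  by rewrite mulf_eq0 (negPf vi) (negPf (diag _)).
rewrite mxE; apply/eqP; apply: contraNT neq_ji; rewrite mulf_eq0 negb_or.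
case/andP=> /i_max le_ji /tri[le_ij eq_ij]; apply/eqP/enum_val_inj/eq_ij.
by apply/eqP; rewrite eqn_leq le_ij; apply/andP.
Qed.

(** * Coefficients of power sums as numbers of mergings *)

Section PowerSumCoefficients.
Variables (K : fieldType) (n : nat).
Implicit Types la mu : intpartn n.

Definition is_merging la mu (f : {ffun 'I_(size mu) -> 'I_(size la)}) :=
  [forall i : 'I_(size la),
     (\sum_(j | f j == i) nth 0 mu j)%N == nth 0%N la i].
Arguments is_merging la mu f : clear implicits.

(** Expanding p_mu chooses a variable x_(f j) for each part mu_j; the resulting monomial is x^la
    exactly when the parts sent to i add up to la_i. *)
Lemma coefsf_psf_part la mu :
  coefsf (parts la) (psf_part K mu) = #|[pred f | is_merging la mu f]|%:R.
Proof.
rewrite /coefsf /psf_part symfun_prodE (big_nth 0%N) big_mkord.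
have pE (j : 'I_(size mu)) : psf K (nth 0%N mu j) (size la)
    = \sum_(i < size la) 'X_[U_(i)] ^+ nth 0%N mu j.
  (* Parts are positive, so the conventional value of [powersum] at 0 does not arise. *)
  have /andP[] := intpartn_bounds (mem_nth 0%N (ltn_ord j)).
  by case: (nth _ _ _).
under eq_bigr do rewrite pE.
rewrite bigA_distr_bigA raddf_sum /= -sum1_card natr_sum [RHS]big_mkcond /=.
apply: eq_bigr => f _; rewrite mprodXnE mcoeffX.
have -> : (\sum_(j < size mu) U_(f j) *+ nth 0%N mu j)%MM == mnm_of la
    = is_merging la mu f.
  apply/eqP/forallP => [eq_m i|merge].
    move/mnmP/(_ i): eq_m; rewrite mnm_sumE mnmE => <-.
    rewrite big_mkcond; apply/eqP/eq_bigr => j _.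
    by rewrite mulmnE mnm1E; case: eqP; rewrite ?mul1n ?mul0n.
  apply/mnmP => i; rewrite mnm_sumE mnmE -(eqP (merge i)).
  rewrite [RHS]big_mkcond; apply: eq_bigr => j _.
  by rewrite mulmnE mnm1E; case: eqP; rewrite ?mul1n ?mul0n.
by rewrite inE; case: is_merging.
Qed.

(** Parts of la are positive, so no fibre of f is empty and f is surjective. With equally many parts
    it is bijective and matches equal parts. *)
Lemma merging_size la mu f : is_merging la mu f ->
  (size la <= size mu)%N /\ (size mu = size la -> mu = la).
Proof.
move=> /forallP merge.
have f_surj i : i \in codom f.
  have /andP[la_i _] := intpartn_bounds (mem_nth 0%N (ltn_ord i)).
  apply: contraTT la_i => /codomP nfi; rewrite -(eqP (merge i)) -leqNgt leqn0.
  by rewrite big_pred0 // => j; apply/eqP => fj; case: nfi; exists j.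
have card_f : #|codom f| = size la.
  by rewrite -[RHS]card_ord; apply: eq_card => i; rewrite f_surj.
split; first by rewrite -card_f -[leqRHS]card_ord leq_image_card.
move=> eq_size; have f_inj : injective f.
  by apply/injectiveP/card_uniqP; rewrite card_f size_codom card_ord.
have nthE (j : 'I_(size mu)) : nth 0%N mu j = nth 0%N la (f j).
  by rewrite -(eqP (merge (f j))) (big_pred1 j) // => k; rewrite (inj_eq f_inj).
have seqE (s : seq nat) :
    s = [seq nth 0%N s (i : 'I_(size s)) | i <- enum 'I_(size s)].
  by rewrite -[LHS](mkseq_nth 0%N) /mkseq -val_enum_ord -map_comp.
apply: intpartn_eq => x; apply/seq.permP.
rewrite [X in perm_eq X _]seqE [X in perm_eq _ X]seqE.
rewrite (eq_map nthE).
rewrite [X in perm_eq X _](map_comp (fun i : 'I_(size la) => nth 0%N la i)).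
rewrite perm_map //.
apply: uniq_perm; [|exact: enum_uniq|].
  by rewrite map_inj_uniq //; apply: enum_uniq.
by move=> i; rewrite mem_enum [LHS]f_surj.
Qed.

Lemma merging_id la : is_merging la la (finfun id).
Proof.
apply/forallP => i; rewrite (big_pred1 i) // => j.
by rewrite ffunE.
Qed.

End PowerSumCoefficients.

(** * The transition matrix from h to m and the basis property *)

Section Transition.
Variables (K : fieldType) (d : option nat).
Hypothesis charK : [pchar K] =i pred0.
Hypothesis d_neq0 : d <> Some 0%N.

Let nat_neq0 m : (0 < m)%N -> m%:R != 0 :> K.
Proof. by rewrite (pcharf0P K).1 // lt0n. Qed.

Lemma zpart_gt0 (s : seq nat) : (0 < zpart s)%N.
Proof.
rewrite /zpart big_add1 big_mkord; apply: prodn_gt0 => i.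
by rewrite muln_gt0 expn_gt0 fact_gt0.
Qed.

Lemma Dpart_neq0 (s : seq nat) : (Dpart d s)%:~R != 0 :> K.
Proof.
case: d d_neq0 => [[|d']|] //= _; last exact: oner_neq0.
by rewrite rmorphXn rmorphN expf_neq0 // oppr_eq0 nat_neq0.
Qed.

Definition hsf_matrix n : 'M[K]_#|{: intpartn n}| :=
  \matrix_(i < #|{: intpartn n}|, j < #|{: intpartn n}|)
    coefsf (parts (enum_val j)) (hsf_part K d (enum_val i)).

Lemma hsf_matrix_unit n : hsf_matrix n \in unitmx.
Proof.
pose M (mu la : intpartn n) : K := coefsf (parts la) (psf_part K mu).
pose R := \matrix_(i < #|{: intpartn n}|, j < #|{: intpartn n}|)
  M (enum_val i) (enum_val j).
pose D := \row_(i < #|{: intpartn n}|)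
  ((zpart (enum_val i))%:R^-1 * (Dpart d (enum_val i))%:~R : K).
have R_unit : R \in unitmx.
  apply: (@triangular_unitmx _ _ (fun mu : intpartn n => size mu)) => [mu|mu la].
    rewrite /M coefsf_psf_part nat_neq0 //; apply/card_gt0P.
    by exists (finfun id); rewrite inE merging_id.
  rewrite /M coefsf_psf_part (pcharf0P K).1 // -lt0n => /card_gt0P[f].
  by rewrite inE => /merging_size.
have D_unit : diag_mx D \in unitmx.
  rewrite unitmxE det_diag unitfE; apply/prodf_neq0 => i _.
  by rewrite mxE mulf_neq0 ?Dpart_neq0 // invr_neq0 // nat_neq0 ?zpart_gt0.
(* The power sum expansion of each h_la, read coefficientwise. *)
have -> : hsf_matrix n = R^T *m diag_mx D *m R; last first.
  by rewrite !unitmx_mul unitmx_tr R_unit D_unit.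
apply/matrixP => i j; rewrite !mxE hsf_part_psf_part // linear_sum /=.
rewrite (reindex _ (onW_bij _ (@enum_val_bij (intpartn n)))) /=.
apply: eq_bigr => k _; rewrite linearZ /= [in RHS]mul_mx_diag !mxE.
by congr (_ * _); rewrite mulrC.
Qed.

Lemma msf_hsf_part n (mu : intpartn n) : exists e : intpartn n -> K,
  msf K mu = \sum_(la : intpartn n) e la *: hsf_part K d la.
Proof.
exists (fun la => invmx (hsf_matrix n) (enum_rank mu) (enum_rank la)).
have homog_n (la : intpartn n) : homogsf n (hsf_part K d la).
  by rewrite -{1}(partsP la).2; apply: homogsf_hsf_part.
transitivity (\sum_(nu : intpartn n)
    (invmx (hsf_matrix n) *m hsf_matrix n) (enum_rank mu) (enum_rank nu)
      *: msf K nu).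
  rewrite mulVmx ?hsf_matrix_unit // (bigD1 mu) //= mxE eqxx scale1r.
  rewrite big1 ?addr0 // => nu neq.
  by rewrite mxE (inj_eq enum_rank_inj) eq_sym (negPf neq) scale0r.
under [RHS]eq_bigr => la _.
  rewrite (homogsf_expand (homog_n la)) scaler_sumr; over.
rewrite exchange_big; apply: eq_bigr => nu _ /=.
rewrite mxE (reindex _ (onW_bij _ (@enum_rank_bij (intpartn n)))) scaler_suml.
by apply: eq_bigr => la _; rewrite mxE !enum_rankK scalerA.
Qed.

(** A linear form extracting the coefficient of h_la gives linear independence across all degrees at
    once. *)
Lemma hsf_part_dual (la : intpart) : exists phi : {scalar symfun K},
  forall mu : intpart, phi (hsf_part K d mu) = (mu == la)%:R.
Proof.
have [la0 def_la] := intpartnP (intpart_subproof la) (erefl (sumn la)).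
set n := sumn la in la0 def_la.
pose G := invmx (hsf_matrix n).
(* The coefficients of f in degree n = |la| are paired with the column of la in the inverse matrix;
   other degrees are sent to 0. *)
pose phi f := \sum_(j < #|{: intpartn n}|)
  coefsf (parts (enum_val j)) f * G j (enum_rank la0).
have phi_scalar : scalar phi.
  move=> a f g; rewrite /phi mulr_sumr -big_split; apply: eq_bigr => j _ /=.
  by rewrite linearP mulrDl mulrA.
pose phiL := GRing.isLinear.Build K (symfun K) K *%R phi phi_scalar.
exists (HB.pack_for {scalar symfun K} phi phiL) => mu /=.
have [eq_mu|neq_mu] := eqVneq (sumn mu) n; last first.
  rewrite [mu == la](_ : _ = false); last first.
    by apply: contraNF neq_mu => /eqP ->.
  rewrite /phi big1 // => j _.
  rewrite (coefsf_homog (homogsf_hsf_part _ _ mu)) ?mul0r //.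
  by rewrite (partsP _).2 eq_sym.
have [mu0 def_mu] := intpartnP (intpart_subproof mu) eq_mu.
transitivity ((hsf_matrix n *m G) (enum_rank mu0) (enum_rank la0)).
  by rewrite mxE; apply: eq_bigr => j _; rewrite mxE enum_rankK def_mu.
rewrite mulmxV ?hsf_matrix_unit // mxE (inj_eq enum_rank_inj).
congr (_ : bool)%:R; apply/eqP/eqP => [eq0|eq_mula].
  by apply/val_inj; rewrite /= -def_mu eq0 def_la.
by apply: parts_inj; rewrite def_mu eq_mula def_la.
Qed.

(** Independence follows by applying the dual forms, spanning by expanding f in monomial functions
    and each of these in the h_la. *)
Lemma hsf_part_basis : is_basis (fun la : intpart => hsf_part K d la).
Proof.
split=> [s c s_uniq sum0 la la_s|f].
  have [phi phiE] := hsf_part_dual la.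
  have /(congr1 phi) := sum0; rewrite linear0 linear_sum /= (bigD1_seq la) //=.
  rewrite linearZ /= phiE eqxx mulr1 big1 ?addr0 // => mu neq.
  by rewrite linearZ /= phiE (negPf neq) mulr0.
suff [s [c [_ def_f]]] : in_span (fun la : intpart => hsf_part K d la) f.
  by exists s, c.
have [D ->] := symfun_expand f.
apply: in_span_sum => n; apply: in_span_sum => mu.
have [e ->] := msf_hsf_part mu; rewrite scaler_sumr.
apply: in_span_sum => la; rewrite scalerA.
exact: (in_spanZ _ _ (IntPart (partsP la).1)).
Qed.

End Transition.

Theorem theorem2p7 (K : fieldType) (charK : [pchar K] =i pred0)
    (d : option nat) (hd : d <> Some 0%N) :
  [/\ forall (n : nat) (R : intpartn n -> intpartn n -> K),
        (forall la : intpartn n,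
           psf_part K la = \sum_(mu : intpartn n) R la mu *: msf K mu) ->
        forall la : intpartn n,
          hsf_part K d la =
          \sum_(mu : intpartn n)
             ((zpart mu)%:R^-1 * (Dpart d mu)%:~R * R mu la) *: psf_part K mu,
      forall la : intpart, Dpart (Some 1%N) la = eps_part la,
      forall la : intpart, Dpart None la = 1
    & is_basis (fun la : intpart => hsf_part K d la)].
Proof.
split=> [n R RP la|||]; [|exact: Dpart1|by []|exact: hsf_part_basis].
rewrite hsf_part_psf_part //; apply: eq_bigr => mu _; congr (_ * _ *: _).
(* Reading the given expansion of p_mu at la forces [R mu la] to be the coefficient of p_mu
   there. *)
rewrite RP linear_sum (bigD1 la) //= linearZ /= coefsf_msf_parts eqxx mulr1.
rewrite big1 ?addr0 // => nu neq.
by rewrite linearZ /= coefsf_msf_parts eq_sym (negPf neq) mulr0.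
Qed.
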